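(* Let $\tilde v\in\mathbb{R}^{d_v}$, $w\in\mathbb{R}^{d_w}$ and $\theta\in\mathbb{S}_\theta$ be given. Suppose that the feedback system $$\dot x(t,\theta)=f(x(t,\theta),\theta)+G(x(t,\theta),\theta)\,\hat u(x(t,\theta),w)$$ is globally asymptotically stable (in particular, for every initial state $x_0\in\mathbb{R}^{d_x}$, $\sup_{t\ge 0}\|x(t,\theta)\|<\infty$ and $\lim_{t\to\infty}x(t,\theta)=0$), and that $J(\hat u(\cdot,w),x,\theta)<\infty$ for each $x\in\mathbb{R}^{d_x}$. If there exists $\beta\ge 0$ such that $$\forall x\in\mathbb{R}^{d_x},\quad B(x,\tilde v,w,\theta)^2\le \beta^2\Big(q(x)+\tfrac12\,\hat u(x,w)^\top R(x)\,\hat u(x,w)\Big)^2,$$ then $$\forall x\in\mathbb{R}^{d_x},\quad \big|\hat J(x,\tilde v)-J(\hat u(\cdot,w),x,\theta)\big|\le \beta\, J(\hat u(\cdot,w),x,\theta).$$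
   Context: Setting and standing assumptions. $\mathbb{S}_\theta\subseteq\mathbb{R}^{d_\theta}$ is a given set; $\theta\in\mathbb{S}_\theta$ is a parameter constant in time. For each $\theta\in\mathbb{S}_\theta$, $f(\cdot,\theta):\mathbb{R}^{d_x}\to\mathbb{R}^{d_x}$ and $G(\cdot,\theta):\mathbb{R}^{d_x}\to\mathbb{R}^{d_x\times d_u}$ are locally Lipschitz continuous in the state, and $f(0,\theta)=0$. Moreover (polytopic dynamics) there are a positive integer $K$, continuous functions $h_k:\mathbb{S}_\theta\to[0,1]$ with $\sum_{k=1}^K h_k(\theta)=1$, and locally Lipschitz functions $f_k:\mathbb{R}^{d_x}\to\mathbb{R}^{d_x}$ with $f_k(0)=0$ and $G_k:\mathbb{R}^{d_x}\to\mathbb{R}^{d_x\times d_u}$ such that $f(x,\theta)=\sum_{k=1}^K h_k(\theta)f_k(x)$ and $G(x,\theta)=\sum_{k=1}^K h_k(\theta)G_k(x)$. Cost. $q:\mathbb{R}^{d_x}\to\mathbb{R}$ is continuous and globally positive definite ($q(0)=0$, $q(x)>0$ for $x\ne0$, and $\lim_{\|x\|\to\infty}q(x)\ne0$); $R:\mathbb{R}^{d_x}\to\mathbb{R}^{d_u\times d_u}$ is continuous and $R(x)$ is symmetric positive definite for every $x$. For a state feedback $u:\mathbb{R}^{d_x}\to\mathbb{R}^{d_u}$, with $x(t,\theta)$ the solution of $\dot x=f(x,\theta)+G(x,\theta)u(x)$ with $x(0,\theta)=x_0$, $$J(u,x_0,\theta):=\lim_{T\to\infty}\int_0^T\Big(q(x(t,\theta))+\tfrac12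 u(x(t,\theta))^\top R(x(t,\theta))u(x(t,\theta))\Big)dt.$$ Parameterization. $\Phi:\mathbb{R}^{d_x}\to\mathbb{R}^{d_w\times d_u}$ is locally Lipschitz continuous, and $\phi:\mathbb{R}^{d_x}\to\mathbb{R}^{d_v}$ is $C^1$ with $\phi(0)=0$. Define $\hat u(x,w):=\Phi(x)^\top w$ for $w\in\mathbb{R}^{d_w}$ and $\hat J(x,\tilde v):=\phi(x)^\top\tilde v$ for $\tilde v\in\mathbb{R}^{d_v}$. Bellman residual. $$B(x,\tilde v,w,\theta):=q(x)+\tfrac12\hat u(x,w)^\top R(x)\hat u(x,w)+\frac{\partial \hat J(x,\tilde v)}{\partial x}^{\top}\Big(f(x,\theta)+G(x,\theta)\hat u(x,w)\Big).$$ *)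

(* Defs.v *)
From HB Require Import structures.
From mathcomp Require Import all_boot all_order all_algebra.
From mathcomp Require Import all_classical all_reals all_analysis.

Set Implicit Arguments.
Unset Strict Implicit.
Unset Printing Implicit Defensive.

Import Order.TTheory GRing.Theory Num.Theory.
Import numFieldNormedType.Exports.

Local Open Scope classical_set_scope.
Local Open Scope ring_scope.

(* R^n is 'cV[R]_n with the library's max norm. The definitions below depend
   on the norm only through its topology, its bounded sets and Lipschitz
   continuity up to a constant, so any other norm would do. *)

Definition locally_lipschitz (R : realType) (V W : normedModType R)
    (f : V -> W) : Prop :=
  forall x : V, exists2 U : set V, nbhs x U & [lipschitz f y | y in U].

Definition continuously_differentiable (R : realType) (n m : nat)
    (f : 'cV[R]_n -> 'cV[R]_m) : Prop :=
  (forall x : 'cV[R]_n, differentiable f x) /\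
  (forall v : 'cV[R]_n, continuous ('D_v f)).

(* Filter of ||x|| --> oo. *)
Definition norm_pinfty_nbhs (R : realType) (V : normedModType R) :
    set_system V :=
  filter_from [set: R] (fun M => [set x : V | M < `|x|]).

(* "lim q(x) <> 0 at infinity" is read as "q(x) does not tend to 0", which
   does not require the limit to exist. *)
Definition globally_positive_definite (R : realType) (n : nat)
    (q : 'cV[R]_n -> R) : Prop :=
  [/\ q 0 = 0,
      forall x : 'cV[R]_n, x != 0 -> 0 < q x
    & ~ (q @ @norm_pinfty_nbhs R 'cV[R]_n --> (0 : R))].

Definition symmetric_positive_definite (R : realType) (n : nat)
    (A : 'M[R]_n) : Prop :=
  A^T = A /\ forall u : 'cV[R]_n, u != 0 -> 0 < (u^T *m A *m u) 0 0.

Definition gradient (R : realType) (n : nat) (V : 'cV[R]_n -> R)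
    (x : 'cV[R]_n) : 'cV[R]_n :=
  \col_(i < n) 'D_(delta_mx i 0) V x.

(* Forward solution of dx/dt = F(x), x(0) = x0. Values at t < 0 are
   irrelevant. For continuous F, the one-sided derivative at t = 0 is F(x0) as
   a consequence of continuity on [0, +oo[ and of the equation for t > 0. *)
Definition is_solution (R : realType) (n : nat) (F : 'cV[R]_n -> 'cV[R]_n)
    (x0 : 'cV[R]_n) (x : R -> 'cV[R]_n) : Prop :=
  [/\ x 0 = x0,
      {within `[0, +oo[, continuous x}
    & forall t : R, 0 < t -> is_derive t 1 x (F (x t))].

(* For locally Lipschitz F the solution is unique on [0, +oo[ if it exists, so
   that the choice made by get only affects times t < 0. *)
Definition solution (R : realType) (n : nat) (F : 'cV[R]_n -> 'cV[R]_n)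
    (x0 : 'cV[R]_n) : R -> 'cV[R]_n :=
  get [set x | is_solution F x0 x].

(* Global existence of solutions, Lyapunov stability of the origin and global
   attractivity of the origin. *)
Definition globally_asymptotically_stable (R : realType) (n : nat)
    (F : 'cV[R]_n -> 'cV[R]_n) : Prop :=
  [/\ forall x0, exists x, is_solution F x0 x,
      forall e : R, 0 < e -> exists2 d : R, 0 < d &
        forall x0 x, is_solution F x0 x -> `|x0| < d ->
          forall t : R, 0 <= t -> `|x t| < e
    & forall x0 x, is_solution F x0 x -> x t @[t --> +oo] --> (0 : 'cV[R]_n)].

Section problem.
Context (R : realType) (dx du dw dv dth : nat).

Variables (f : 'cV[R]_dx -> 'cV[R]_dth -> 'cV[R]_dx)
          (G : 'cV[R]_dx -> 'cV[R]_dth -> 'M[R]_(dx, du)).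

Definition closed_loop (u : 'cV[R]_dx -> 'cV[R]_du) (theta : 'cV[R]_dth)
    (x : 'cV[R]_dx) : 'cV[R]_dx :=
  f x theta + G x theta *m u x.

Variables (q : 'cV[R]_dx -> R) (Rm : 'cV[R]_dx -> 'M[R]_du).

Definition running_cost (u : 'cV[R]_dx -> 'cV[R]_du) (x : 'cV[R]_dx) : R :=
  q x + 2^-1 * ((u x)^T *m Rm x *m u x) 0 0.

(* The integrand is nonnegative when q >= 0 and Rm is positive definite, so
   that the limit exists in the extended reals. *)
Definition cost (u : 'cV[R]_dx -> 'cV[R]_du) (x0 : 'cV[R]_dx)
    (theta : 'cV[R]_dth) : \bar R :=
  lim ((\int[lebesgue_measure]_(t in `[0%R, T])
          (running_cost u (solution (closed_loop u theta) x0 t))%:E)%E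
        @[T --> +oo%R]).

Variables (Phi : 'cV[R]_dx -> 'M[R]_(dw, du)) (phi : 'cV[R]_dx -> 'cV[R]_dv).

Definition uhat (x : 'cV[R]_dx) (w : 'cV[R]_dw) : 'cV[R]_du :=
  (Phi x)^T *m w.

Definition Jhat (x : 'cV[R]_dx) (v : 'cV[R]_dv) : R :=
  ((phi x)^T *m v) 0 0.

Definition bellman_residual (x : 'cV[R]_dx) (v : 'cV[R]_dv) (w : 'cV[R]_dw)
    (theta : 'cV[R]_dth) : R :=
  running_cost (uhat ^~ w) x +
  ((gradient (Jhat ^~ v) x)^T *m closed_loop (uhat ^~ w) theta x) 0 0.

End problem.

(* Main.v *)
Require Import Defs.
From HB Require Import structures.
From mathcomp Require Import all_boot all_order all_algebra.
From mathcomp Require Import all_classical all_reals all_analysis.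
From mathcomp Require Import ring lra.

(** Along the closed-loop trajectory [x] from [x0], put [V t := Jhat (x t)] and
    [c t := running_cost (x t) >= 0].  By the chain rule the Bellman residual
    at [x t] is [c t + V' t], so the hypothesis says [`|c + V'| <= beta * c],
    that is

      [- (1 + beta) * c <= V' <= (beta - 1) * c].

    Integrating from [0] to [T] bounds [V T - V 0] between
    [- (1 + beta) * I T] and [(beta - 1) * I T], with [I T] the cost accumulated
    up to time [T].  As [T] grows, [V T] tends to [Jhat 0 = 0] by attractivity
    of the origin and [I T] tends to the cost [J], finite by assumption; the
    limit inequalities are [`|V 0 - J| <= beta * J].

    The integration step is the mean value theorem applied to [V - k * I]
    ([integral_comparison]).  The passage to the limit is [value_cost_error];
    both lemmas concern scalar functions only.  The chain rule is [is_derive_along]. *)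

Set Implicit Arguments.
Unset Strict Implicit.
Unset Printing Implicit Defensive.

Import Order.TTheory GRing.Theory Num.Theory.
Import numFieldNormedType.Exports.

Local Open Scope classical_set_scope.
Local Open Scope ring_scope.

(** * Continuity and sign of the running cost *)

Section running_cost.
Context (R : realType).

Lemma locally_lipschitz_continuous (V W : normedModType R) (f : V -> W) :
  locally_lipschitz f -> continuous f.
Proof.
move=> + x => /(_ x)[U Ux [M [_ Mlip]]].
(* The constant must be positive for the division below, and exceed the
   threshold [M] from which on the Lipschitz bound holds. *)
pose k := `|M| + 1.
have k0 : 0 < k by rewrite ltr_wpDl.
have /Mlip klip : M < k by rewrite (le_lt_trans (ler_norm M))// ltrDl.
apply/cvgrPdist_le => e e0; near=> y.
have Uy : U y by near: y.
apply: le_trans (klip (x, y) _) _.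
  by split => //=; exact: nbhs_singleton.
rewrite /= mulrC -ler_pdivlMr//; near: y.
by apply: cvgr_dist_le; [exact: cvg_id|exact: divr_gt0].
Unshelve. all: by end_near. Qed.

(** Continuity of matrices is handled entry by entry: the quadratic form in the
    running cost is one entry of a product, hence a finite sum of products of
    continuous scalar functions. *)
Lemma continuous_mulmx_coord (T : topologicalType) (m n p : nat)
    (A : T -> 'M[R]_(m, n)) (B : T -> 'M[R]_(n, p)) :
  (forall i j, continuous (fun t => A t i j)) ->
  (forall i j, continuous (fun t => B t i j)) ->
  forall i j, continuous (fun t => (A t *m B t) i j).
Proof.
move=> cA cB i j t; under eq_fun do rewrite mxE.
apply: cvg_big => [|k _]; first exact: add_continuous.
by apply: cvgM; [exact: cA|exact: cB].
Qed.

Lemma continuous_coord (T : topologicalType) (m n : nat)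
    (A : T -> 'M[R]_(m, n)) :
  continuous A -> forall i j, continuous (fun t => A t i j).
Proof.
move=> cA i j t; apply: (@continuous_comp _ _ _ A (fun M => M i j)).
  exact: cA.
exact: coord_continuous.
Qed.

Lemma continuous_running_cost (n m : nat) (q : 'cV[R]_n -> R)
    (Rm : 'cV[R]_n -> 'M[R]_m) (u : 'cV[R]_n -> 'cV[R]_m) :
  continuous q -> continuous Rm ->
  (forall i j, continuous (fun x => u x i j)) ->
  continuous (running_cost q Rm u).
Proof.
move=> cq cRm cu x; apply: (cvgD (cq x)).
apply: cvgMl_tmp.
apply: (@continuous_mulmx_coord _ _ _ _ (fun x => (u x)^T *m Rm x) u) => //.
apply: continuous_mulmx_coord; last exact: continuous_coord.
by move=> i j; under eq_fun do rewrite mxE; exact: cu.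
Qed.

Lemma running_cost_ge0 (n m : nat) (q : 'cV[R]_n -> R)
    (Rm : 'cV[R]_n -> 'M[R]_m) (u : 'cV[R]_n -> 'cV[R]_m) :
  globally_positive_definite q ->
  (forall x, symmetric_positive_definite (Rm x)) ->
  forall x, 0 <= running_cost q Rm u x.
Proof.
move=> [q0 q_gt0 _] Rpd x; apply: addr_ge0.
  by have [->|/q_gt0/ltW//] := eqVneq x 0; rewrite q0.
apply: mulr_ge0; first by rewrite invr_ge0.
have [->|u0] := eqVneq (u x) 0; first by rewrite mulmx0 mxE.
by apply: ltW; apply: (Rpd x).2.
Qed.

End running_cost.

(** * Derivative of the value approximation along a trajectory *)

Section gradient.
Context (R : realType) (n : nat).

Lemma diff_gradient (V : 'cV[R]_n -> R) (x y : 'cV[R]_n) :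
  differentiable V x -> 'd V x y = ((gradient V x)^T *m y) 0 0.
Proof.
move=> dV; have -> : y = \sum_i y i 0 *: delta_mx i 0.
  rewrite [LHS]matrix_sum_delta; apply: eq_bigr => i _.
  by rewrite big_ord1.
rewrite linear_sum mulmx_sumr summxE; apply: eq_bigr => i _.
rewrite linearZ -scalemxAr mxE; congr (_ * _).
rewrite mxE (bigD1 i)//= !mxE !eqxx mulr1 big1 ?addr0 ?deriveE// => j ji.
by rewrite !mxE (negbTE ji) mulr0.
Qed.

(** The chain rule in the form met in the Bellman residual: with [dx] the value
    of the vector field at [x t], the right-hand side is its gradient term. *)
Lemma is_derive_along (V : 'cV[R]_n -> R) (x : R -> 'cV[R]_n) (t : R)
    (dx : 'cV[R]_n) :
  is_derive t 1 x dx -> differentiable V (x t) ->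
  is_derive t 1 (V \o x) (((gradient V (x t))^T *m dx) 0 0).
Proof.
move=> [/derivable1_diffP dfx <-] dV.
have dVx : differentiable (V \o x) t by exact: differentiable_comp.
apply: DeriveDef; first exact/derivable1_diffP.
rewrite deriveE// diff_comp//= diff_gradient//.
by rewrite deriveE.
Qed.

Lemma differentiable_Jhat (p : nat) (phi : 'cV[R]_n -> 'cV[R]_p)
    (v : 'cV[R]_p) (x : 'cV[R]_n) :
  differentiable phi x -> differentiable (Jhat phi ^~ v) x.
Proof.
move=> dphi.
have -> : Jhat phi ^~ v = \sum_(i < p) (fun y => phi y i 0 * v i 0).
  apply/funext => y; rewrite fct_sumE /Jhat mxE.
  by apply: eq_bigr => i _; rewrite mxE.
apply: differentiable_sum => i; apply: differentiableM => //.
apply: (@differentiable_comp _ _ _ _ phi (fun N : 'cV[R]_p => N i 0)) => //.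
exact: differentiable_coord.
Qed.

End gradient.

(** * Scalar comparison of a value with an accumulated cost *)

Section dissipation.
Context (R : realType).
Notation mu := (@lebesgue_measure R).

Context (c : R -> R) (c_cont : {within `[0, +oo[, continuous c}).

Lemma integrable_segment0 T : mu.-integrable `[0, T] (EFin \o c).
Proof.
apply: continuous_compact_integrable; first exact: segment_compact.
by apply: continuous_subspaceW c_cont => t /=; rewrite !in_itv/= => /andP[->].
Qed.

(** [V - k * I], with [I] the integral of [c] from [0], has derivative
    [dV - k * c <= 0], so it does not increase.  The mean value theorem asks for
    differentiability only in the open interval, which suits a trajectory whose
    equation is imposed at positive times and which is only continuous at 0. *)
Lemma integral_comparison (V dV : R -> R) (k T : R) :
  {within `[0, +oo[, continuous V} ->
  (forall t : R, 0 < t -> is_derive t 1 V (dV t)) ->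
  (forall t : R, 0 < t -> dV t <= k * c t) -> 0 < T ->
  V T - V 0 <= k * (\int[mu]_(t in `[0, T]) c t)%R.
Proof.
move=> cV V' dVc T0.
pose I t := (\int[mu]_(s in `[0, t]) c s)%R.
have I' (t : R) : 0 < t -> is_derive t 1 I (c t).
  move=> t0.
  have ct : {for t, continuous c}.
    have /continuous_within_itvcyP[+ _] := c_cont.
    by apply; rewrite in_itv/= t0.
  have tlt : t < t + 1 by rewrite ltrDl.
  have [dI IE] := continuous_FTC1_closed tlt
    (integrable_segment0 (t + 1)) t0 ct.
  by apply: DeriveDef => //; rewrite -derive1E.
have cI : {within `[0, T], continuous I}.
  exact: parameterized_integral_continuous (ltW T0) (integrable_segment0 T).
have I0 : I 0 = 0 by rewrite /I set_itv1 Rintegral_set1.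
have [t] : exists2 t, t \in `]0, T[%R &
    (V - k \*: I) T - (V - k \*: I) 0 = (dV t - k *: c t) * (T - 0).
  apply: MVT => // [t|].
    rewrite in_itv/= => /andP[t0 _].
    have := V' _ t0; have := I' _ t0 => ? ?.
    exact: is_deriveB.
  have cV' : {within `[0, T], continuous V}.
    by apply: continuous_subspaceW cV => s /=; rewrite !in_itv/= => /andP[->].
  move=> t; apply: (@continuousB _ _ (subspace `[0, T]) V (k \*: I) t).
    exact: cV'.
  by apply: continuousZl_tmp; exact: cI.
rewrite in_itv/= => /andP[t0 _].
have -> : (V - k \*: I) T - (V - k \*: I) 0 = V T - V 0 - k * I T.
  rewrite -[LHS]/(V T - k * I T - (V 0 - k * I 0)) I0; ring.
move=> E; rewrite -subr_le0 E subr0 pmulr_lle0// subr_le0.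
exact: dVc.
Qed.

(** Both bounds on the derivative of [V] are integrated on [[0, T]], the lower
    one by applying the comparison to [- V], and then [T] tends to infinity.
    Nonnegativity of [c] makes the accumulated cost monotone in [T], so that
    [J] is a genuine limit. *)
Lemma value_cost_error (V dV : R -> R) (beta : R) :
  (forall t : R, 0 <= t -> 0 <= c t) ->
  {within `[0, +oo[, continuous V} ->
  (forall t : R, 0 < t -> is_derive t 1 V (dV t)) ->
  (forall t : R, 0 < t -> `|c t + dV t| <= beta * c t) ->
  V t @[t --> +oo] --> 0 ->
  let J := lim ((\int[mu]_(t in `[0%R, T]) (c t)%:E)%E @[T --> +oo%R]) in
  (J < +oo)%E ->
  (`|(V 0)%:E - J| <= beta%:E * J)%E.
Proof.
move=> c0 cV V' Vc V0 J Joo.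
pose Ie T := (\int[mu]_(t in `[0%R, T]) (c t)%:E)%E.
pose I T := (\int[mu]_(t in `[0%R, T]) c t)%R.
have cIe : cvg (Ie T @[T --> +oo%R]).
  apply: nondecreasing_is_cvge => S T ST.
  apply: ge0_subset_integral => //.
  - by have /integrableP[] := integrable_segment0 T.
  - by move=> t /=; rewrite in_itv/= => /andP[t0 _]; rewrite lee_fin c0.
  - by apply: subset_itvl; rewrite bnd_simp.
have J0 : (0 <= J)%E.
  apply: lime_ge => //; apply: nearW => T; apply: integral_ge0 => t /=.
  by rewrite in_itv/= => /andP[t0 _]; rewrite lee_fin c0.
have Jfin : J \is a fin_num by rewrite ge0_fin_numE.
have IJ : I T @[T --> +oo%R] --> fine J.
  have : Ie T @[T --> +oo%R] --> (fine J)%:E by rewrite fineK.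
  by move=> /fine_cvgP[_].
have bnd T : 0 < T -> - (1 + beta) * I T <= V T - V 0 <= (beta - 1) * I T.
  move=> T0; apply/andP; split; last first.
    apply: integral_comparison cV V' _ T0 => t /Vc.
    by rewrite ler_norml => /andP[_]; lra.
  have := @integral_comparison (\- V) (\- dV) (1 + beta) T.
  rewrite -/(I T) => h; suff : - V T - - V 0 <= (1 + beta) * I T by lra.
  apply: h => //.
  - by move=> t; apply: continuousN; exact: cV.
  - by move=> t /V' ?; exact: is_deriveN.
  - by move=> t /Vc; rewrite ler_norml => /andP[+ _] /=; lra.
have lo : - V 0 + (1 + beta) * fine J >= 0.
  have : (V T - V 0) + (1 + beta) * I T @[T --> +oo%R] -->
         (0 - V 0) + (1 + beta) * fine J.
    by apply: cvgD; [apply: cvgB => //; exact: cvg_cst|exact: cvgMl_tmp].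
  rewrite sub0r => /cvgr_to_ge; apply; near=> T.
  have /bnd/andP[+ _] : 0 < T by near: T; exact: nbhs_pinfty_gt.
  by lra.
have up : - V 0 - (beta - 1) * fine J <= 0.
  have : (V T - V 0) - (beta - 1) * I T @[T --> +oo%R] -->
         (0 - V 0) - (beta - 1) * fine J.
    by apply: cvgB; [apply: cvgB => //; exact: cvg_cst|exact: cvgMl_tmp].
  rewrite sub0r => /cvgr_to_le; apply; near=> T.
  have /bnd/andP[_ +] : 0 < T by near: T; exact: nbhs_pinfty_gt.
  by lra.
rewrite -(fineK Jfin) -EFinB -EFinM abse_EFin lee_fin ler_norml.
by apply/andP; split; lra.
Unshelve. all: by end_near. Qed.

End dissipation.

(** * Error of the value approximation *)

Theorem theorem1 (R : realType) (dx du dw dv dth : nat)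
    (S : set 'cV[R]_dth)
    (f : 'cV[R]_dx -> 'cV[R]_dth -> 'cV[R]_dx)
    (G : 'cV[R]_dx -> 'cV[R]_dth -> 'M[R]_(dx, du))
    (f_lip : forall theta, S theta -> locally_lipschitz (f ^~ theta))
    (G_lip : forall theta, S theta -> locally_lipschitz (G ^~ theta))
    (f0 : forall theta, S theta -> f 0 theta = 0)
    (K : nat) (K_gt0 : (0 < K)%N)
    (h : 'I_K -> 'cV[R]_dth -> R)
    (fk : 'I_K -> 'cV[R]_dx -> 'cV[R]_dx)
    (Gk : 'I_K -> 'cV[R]_dx -> 'M[R]_(dx, du))
    (h_cont : forall k, {within S, continuous (h k)})
    (h_itv : forall k theta, S theta -> 0 <= h k theta <= 1)
    (h_sum : forall theta, S theta -> \sum_(k < K) h k theta = 1)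
    (fk_lip : forall k, locally_lipschitz (fk k))
    (fk0 : forall k, fk k 0 = 0)
    (Gk_lip : forall k, locally_lipschitz (Gk k))
    (f_poly : forall x theta, S theta ->
      f x theta = \sum_(k < K) h k theta *: fk k x)
    (G_poly : forall x theta, S theta ->
      G x theta = \sum_(k < K) h k theta *: Gk k x)
    (q : 'cV[R]_dx -> R) (q_cont : continuous q)
    (q_pd : globally_positive_definite q)
    (Rm : 'cV[R]_dx -> 'M[R]_du) (Rm_cont : continuous Rm)
    (Rm_spd : forall x, symmetric_positive_definite (Rm x))
    (Phi : 'cV[R]_dx -> 'M[R]_(dw, du)) (Phi_lip : locally_lipschitz Phi)
    (phi : 'cV[R]_dx -> 'cV[R]_dv)
    (phi_C1 : continuously_differentiable phi) (phi0 : phi 0 = 0)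
    (v : 'cV[R]_dv) (w : 'cV[R]_dw) (theta : 'cV[R]_dth) (Stheta : S theta)
    (gas : globally_asymptotically_stable
             (closed_loop f G (uhat Phi ^~ w) theta))
    (J_fin : forall x, (cost f G q Rm (uhat Phi ^~ w) x theta < +oo)%E)
    (beta : R) (beta_ge0 : 0 <= beta)
    (B_le : forall x,
      bellman_residual f G q Rm Phi phi x v w theta ^+ 2 <=
      beta ^+ 2 *
      (q x + 2^-1 * ((uhat Phi x w)^T *m Rm x *m uhat Phi x w) 0 0) ^+ 2) :
  forall x,
    (`|(Jhat phi x v)%:E - cost f G q Rm (uhat Phi ^~ w) x theta| <=
     beta%:E * cost f G q Rm (uhat Phi ^~ w) x theta)%E.
Proof.
move=> x0.
set u := uhat Phi ^~ w.
set F := closed_loop f G u theta.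
have [sol_ex _ attr] := gas.
have xP : is_solution F x0 (solution F x0) := getPex (sol_ex x0).
set x := solution F x0 in xP.
have [x0E cx x'] := xP.
have u_cont i j : continuous (fun y => u y i j).
  apply: continuous_mulmx_coord => [k l|k l]; last exact: cst_continuous.
  under eq_fun do rewrite mxE.
  exact/continuous_coord/locally_lipschitz_continuous.
have c_cont : continuous (running_cost q Rm u) by exact: continuous_running_cost.
have V_diff y : differentiable (Jhat phi ^~ v) y.
  exact/differentiable_Jhat/phi_C1.1.
have V_cont : continuous (Jhat phi ^~ v).
  by move=> y; exact: differentiable_continuous.
have V0 : Jhat phi 0 v = 0 by rewrite /Jhat phi0 trmx0 mul0mx mxE.
(* [Jhat phi x0 v] becomes the value at time 0 of [Jhat] along [x]. *)
rewrite -{1}x0E.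
pose dV t := ((gradient (Jhat phi ^~ v) (x t))^T *m F (x t)) 0 0.
apply: (@value_cost_error _ (running_cost q Rm u \o x) _
          (Jhat phi ^~ v \o x) dV).
- by apply: within_continuous_comp => // y _; exact: c_cont.
- by move=> t _; exact: running_cost_ge0.
- by apply: within_continuous_comp => // y _; exact: V_cont.
- by move=> t /x' xt; exact: is_derive_along.
- move=> t t0 /=; have := B_le (x t).
  have c0 := running_cost_ge0 u q_pd Rm_spd (x t).
  rewrite -exprMn -[X in X <= _]real_normK ?num_real// ler_sqr ?nnegrE//.
  exact: mulr_ge0.
- rewrite -[X in _ --> X]V0.
  exact: (cvg_comp _ _ (attr _ _ xP) (V_cont 0)).
- exact: J_fin.
Qed.
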